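(* Let $0<r_{\min}<r_{\max}$, let $\mathcal{R}=[r_{\min},r_{\max}]$ and $D(\mathcal{R})=r_{\max}-r_{\min}$, let $q\ge 0$ be an integer, and let $r$ be uniformly distributed on $\mathcal{R}$. Consider partitions of $\mathcal{R}$ into $2^q$ non-overlapping intervals $\mathcal{I}_1,\dots,\mathcal{I}_{2^q}$ whose union is $\mathcal{R}$, with breakpoints $r_{\min}=\dot r_0<\dot r_1<\cdots<\dot r_{2^q}=r_{\max}$, where $\mathcal{I}_i=[\dot r_{i-1},\dot r_i)$ (the last interval also contains $r_{\max}$). Set $D(\mathcal{I}_i)=\dot r_i-\dot r_{i-1}$ and $\xi_i=\sqrt{\dot r_i/\dot r_{i-1}}$. Then the optimal solution of the minimization problem $$\min_{\{\mathcal{I}_i\}}\ \sum_{i=1}^{2^q}\frac{2}{D(\mathcal{I}_i)}\left(\log\frac{\xi_i+1/\xi_i}{2}\right)\Pr(r\in\mathcal{I}_i)$$ over all such partitions is $$\mathcal{I}_i^*=\left[\,r_{\min}\left(\frac{r_{\max}}{r_{\min}}\right)^{\frac{i-1}{2^q}},\ r_{\min}\left(\frac{r_{\max}}{r_{\min}}\right)^{\frac{i}{2^q}}\right),\qquad i=1,\dots,2^q$$ (the last interval also containing $r_{\max}$), and the optimized objective is $$\frac{2^{q}}{D(\mathcal{R})}\left(\log\frac{\xi^{1/2^q}+\xi^{-1/2^q}}{2}\right),\qquad \text{where } \xi=\sqrt{\frac{r_{\max}}{r_{\min}}}.$$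
   Context: Here $\log$ is the natural logarithm. The number $r$ models the distance of a user from a base station. The partition is the decision variable; equivalently, one optimizes over the breakpoints $r_{\min}=\dot r_0<\dot r_1<\cdots<\dot r_{2^q}=r_{\max}$. The objective is an expected range sampling error: each cell $\mathcal{I}_i$ is represented by its midpoint $\hat r_i=(\dot r_{i-1}+\dot r_i)/2$, and the error of representing $r\in\mathcal{I}_i$ by $\hat r_i$ is $|1/r-1/\hat r_i|$.
   Formalization: The optimized objective is stated with the factor 2^{q+1}/D(R) in place of the printed 2^q/D(R), which is off by a factor of 2 from the given objective (e.g. q=0 gives (2/D(R)) log((ξ+1/ξ)/2)). *)

(* Defs.v *)
From HB Require Export structures.
From mathcomp Require Export all_boot all_order all_algebra.
From mathcomp Require Export all_classical all_reals all_analysis.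

Set Implicit Arguments.
Unset Strict Implicit.
Unset Printing Implicit Defensive.

Import Order.TTheory GRing.Theory Num.Theory.

Local Open Scope classical_set_scope.
Local Open Scope ring_scope.

Definition uniformly_distributed (R : realType) (d : measure_display)
    (T : measurableType d) (P : probability T R) (X : {RV P >-> R})
    (a b : R) (ab : a < b) : Prop :=
  forall A : set R, measurable A -> distribution P X A = uniform_prob ab A.

Section Breakpoints.
Variables (R : realType) (n : nat).

(* A partition into n consecutive intervals is given by its n + 1 breakpoints.
   Cells are numbered from 0: cell i lies between breakpoints i and i + 1. *)
Implicit Type b : 'I_n.+1 -> R.

Definition is_partition (a c : R) b : Prop :=
  [/\ b ord0 = a, b ord_max = c &
      forall i j : 'I_n.+1, (i < j)%N -> b i < b j].

Definition left_end b (i : 'I_n) : R := b (widen_ord (leqnSn n) i).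

Definition right_end b (i : 'I_n) : R := b (lift ord0 i).

Definition cell b (i : 'I_n) : set R :=
  if i.+1 == n then [set` `[left_end b i, right_end b i]]
  else [set` `[left_end b i, right_end b i[].

Definition cell_length b i : R := right_end b i - left_end b i.

Definition cell_ratio b i : R := Num.sqrt (right_end b i / left_end b i).

Definition range_sampling_error (d : measure_display) (T : measurableType d)
    (P : probability T R) (X : {RV P >-> R}) b : R :=
  \sum_(i < n) 2 / cell_length b i
    * ln ((cell_ratio b i + (cell_ratio b i)^-1) / 2)
    * fine (P (X @^-1` cell b i)).

Definition geometric_breakpoints (a c : R) (k : 'I_n.+1) : R :=
  a * (c / a) `^ (k%:R / n%:R).

End Breakpoints.

Definition is_minimizer (R : realType) (S : Type) (feasible : S -> Prop)
    (f : S -> R) (x : S) : Prop :=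
  feasible x /\ forall y, feasible y -> f x <= f y.

(* Main.v *)
Require Import Defs.
From mathcomp Require Import ring.

(* Since the law is uniform, the probability of a cell is proportional to its
   length, which cancels the factor 1 / D(I_i): with u_i = ln xi_i the objective
   is 2 / D(R) times the sum of ln (cosh u_i). The sum of the u_i telescopes to
   ln xi for every partition, so strict convexity of ln cosh makes equal u_i,
   that is, geometric breakpoints, the unique minimizer. Strict convexity is used
   through the tangent line at the mean. *)

Set Implicit Arguments.
Unset Strict Implicit.
Unset Printing Implicit Defensive.

Import Order.TTheory GRing.Theory Num.Theory.

Local Open Scope classical_set_scope.
Local Open Scope ring_scope.

(** * Strict convexity of log cosh and the equality case of Jensen *)

Definition logcosh (R : realType) (x : R) : R := ln ((expR x + expR (- x)) / 2).

(** This is [tanh], the derivative of [logcosh]. *)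
Definition logcosh_slope (R : realType) (x : R) : R :=
  (expR x - expR (- x)) / (expR x + expR (- x)).

Lemma logcosh_tangent_lt (R : realType) (m x : R) : x != m ->
  logcosh m + logcosh_slope m * (x - m) < logcosh x.
Proof.
move=> xm; have s0 : x - m != 0 by rewrite subr_eq0.
rewrite -{2}(subrK m x) addrC; move: (x - m) s0 => s s0 {xm}.
set S := expR m + expR (- m).
have S0 : 0 < S by rewrite addr_gt0 ?expR_gt0.
(* Weights with sum 1 whose difference is [tanh m]. Since [cosh (m + s) / cosh m = p * expR s + r *
   expR (- s)], exponentiating the tangent inequality turns it into a weighted AM-GM. *)
set p := expR m / S; set r := expR (- m) / S.
have p0 : 0 < p by rewrite divr_gt0 ?expR_gt0.
have r0 : 0 < r by rewrite divr_gt0 ?expR_gt0.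
have pr : p + r = 1 by rewrite -mulrDl divff ?gt_eqF.
have sE : s = (p + r) * s by rewrite pr mul1r.
have slopeE : logcosh_slope m = p - r by rewrite /logcosh_slope mulrBl.
have pS : expR m = p * S by rewrite divfK ?gt_eqF.
have rS : expR (- m) = r * S by rewrite divfK ?gt_eqF.
clearbody p r.
(* Weighted AM-GM: [expR ((p - r) s) < p expR s + r expR (- s)], which is
   [1 + z < expR z] at [z = 2 r s] and [z = - 2 p s]. *)
have amgm : expR ((p - r) * s) < p * expR s + r * expR (- s).
  have -> : expR s = expR ((p - r) * s) * expR (2 * r * s).
    by rewrite -expRD; congr expR; rewrite {1}sE; ring.
  have -> : expR (- s) = expR ((p - r) * s) * expR (- (2 * p * s)).
    by rewrite -expRD; congr expR; rewrite {1}sE; ring.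
  rewrite (mulrCA p) (mulrCA r) -mulrDr -[ltLHS]mulr1 ltr_pM2l ?expR_gt0//.
  have h1 : 1 + 2 * r * s < expR (2 * r * s).
    by rewrite expR_gt1Dx// !mulf_neq0// gt_eqF.
  have h2 : 1 - 2 * p * s < expR (- (2 * p * s)).
    by rewrite expR_gt1Dx// oppr_eq0 !mulf_neq0// gt_eqF.
  (* Weighted by [p] and [r], the terms linear in [s] cancel. *)
  have e : 1 = p * (1 + 2 * r * s) + r * (1 - 2 * p * s)
    by rewrite -{1}pr; ring.
  by rewrite [ltLHS]e ltrD// ltr_pM2l.
rewrite slopeE -ltr_expR expRD /logcosh.
rewrite !lnK ?posrE ?divr_gt0 ?addr_gt0 ?expR_gt0//.
rewrite opprD !expRD.
have -> : (expR s * expR m + expR (- s) * expR (- m)) / 2 =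
          S / 2 * (p * expR s + r * expR (- s)).
  by rewrite pS rS; ring.
by rewrite -/S mulrC ltr_pM2l ?divr_gt0.
Qed.

(** The deviations from the mean [m] sum to zero, so the slope terms vanish. *)
Lemma sum_logcosh_tangent (R : realType) (n : nat) (u : 'I_n -> R) (m : R) :
  \sum_(i < n) u i = n%:R * m ->
  n%:R * logcosh m =
    \sum_(i < n) (logcosh m + logcosh_slope m * (u i - m)).
Proof.
move=> um; rewrite big_split/= -mulr_sumr sumrB um !sumr_const card_ord.
by rewrite !mulr_natl subrr mulr0 addr0.
Qed.

Lemma logcosh_sum_ge (R : realType) (n : nat) (u : 'I_n -> R) (m : R) :
  \sum_(i < n) u i = n%:R * m -> n%:R * logcosh m <= \sum_(i < n) logcosh (u i).
Proof.
move=> um; rewrite (sum_logcosh_tangent um).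
apply: ler_sum => i _; have [->|/logcosh_tangent_lt/ltW//] := eqVneq (u i) m.
by rewrite subrr mulr0 addr0.
Qed.

(** Equality case of Jensen: a single [u i] away from [m] makes its tangent bound strict, and hence
    the bound on the whole sum. *)
Lemma logcosh_sum_eq (R : realType) (n : nat) (u : 'I_n -> R) (m : R) :
  \sum_(i < n) u i = n%:R * m -> \sum_(i < n) logcosh (u i) <= n%:R * logcosh m ->
  forall i, u i = m.
Proof.
move=> um le_um i; apply/eqP; apply: contraLR le_um => uim; rewrite -ltNge.
rewrite (sum_logcosh_tangent um) (bigD1 i)//= [ltRHS](bigD1 i)//=.
apply: ltr_leD; first exact: logcosh_tangent_lt.
apply: ler_sum => j _; have [->|/logcosh_tangent_lt/ltW//] := eqVneq (u j) m.
by rewrite subrr mulr0 addr0.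
Qed.

(** The density is constant on [[a, c]], so its integral over [A] is that constant times the measure
    of [A]. *)
Lemma uniform_prob_subset (R : realType) (a c : R) (ac : a < c) (A : set R) :
  measurable A -> A `<=` `[a, c] ->
  uniform_prob ac A = ((c - a)^-1%:E * lebesgue_measure A)%E.
Proof.
move=> mA Aac; rewrite /uniform_prob.
rewrite (@eq_integral _ _ _ _ _ (cst (c - a)^-1%:E)) ?integral_cst//.
by move=> x; rewrite inE => /Aac; rewrite /= in_itv/= /uniform_pdf => ->.
Qed.

(** * The objective as a sum of log cosh over the cells *)

Section Partition.
Variables (R : realType) (n : nat) (a c : R) (a_gt0 : 0 < a) (ac : a < c).
Implicit Type b : 'I_n.+1 -> R.

(** The logarithm of [cell_ratio], written as a difference so that its sum over the cells
    telescopes. *)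
Definition half_log_ratio b i : R := (ln (right_end b i) - ln (left_end b i)) / 2.

Lemma sum_half_log_ratio b : b ord0 = a -> b ord_max = c ->
  \sum_(i < n) half_log_ratio b i = (ln c - ln a) / 2.
Proof.
move=> b0 bn; rewrite -mulr_suml sumrB; congr (_ / _).
(* The sum over all [n + 1] breakpoints is split at its first term on one side and at its last on
   the other. *)
have := erefl (\sum_(i < n.+1) ln (b i)).
rewrite {1}big_ord_recl big_ord_recr/= b0 bn.
by rewrite /right_end /left_end => e; rewrite -[X in X - _](addKr (ln a)) e; ring.
Qed.

Lemma partition_le b (i j : 'I_n.+1) :
  is_partition a c b -> (i <= j)%N -> b i <= b j.
Proof.
move=> [_ _ mb]; rewrite leq_eqVlt => /orP[/eqP/val_inj->//|/mb/ltW//].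
Qed.

Lemma partition_gt0 b i : is_partition a c b -> 0 < b i.
Proof.
move=> pb; rewrite (lt_le_trans a_gt0)//; case: (pb) => <- _ _.
exact: partition_le.
Qed.

Lemma cell_length_gt0 b i : is_partition a c b -> 0 < cell_length b i.
Proof. by case=> _ _ mb; rewrite subr_gt0; apply: mb; rewrite lift0. Qed.

Lemma cell_ratioE b i : is_partition a c b ->
  cell_ratio b i = expR (half_log_ratio b i).
Proof.
move=> pb; have l0 : 0 < left_end b i by exact: partition_gt0.
have r0 : 0 < right_end b i by exact: partition_gt0.
rewrite /cell_ratio /half_log_ratio -powR12_sqrt ?divr_ge0// ?ltW//.
by rewrite expRM expRB !lnK.
Qed.

Lemma cell_subset b i : is_partition a c b -> cell b i `<=` `[a, c].
Proof.
move=> pb; case: (pb) => <- <- _.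
have l : b ord0 <= left_end b i by exact: partition_le.
have r : right_end b i <= b ord_max by apply: partition_le => //; exact: leq_ord.
rewrite /cell; case: ifP => _ x /=; rewrite !in_itv/= => /andP[lx xr].
  by rewrite (le_trans l)// (le_trans xr).
by rewrite (le_trans l)// (le_trans (ltW xr)).
Qed.

Lemma measurable_cell b i : measurable (cell b i).
Proof. by rewrite /cell; case: ifP => _; exact: measurable_itv. Qed.

Lemma lebesgue_measure_cell b i : is_partition a c b ->
  lebesgue_measure (cell b i) = (cell_length b i)%:E.
Proof.
move=> /(cell_length_gt0 i); rewrite /cell_length subr_gt0 => lr.
by rewrite /cell; case: ifP => _; rewrite lebesgue_measure_itv/= lte_fin lr EFinB.
Qed.

Lemma range_sampling_errorE (d : measure_display) (T : measurableType d)
    (P : probability T R) (X : {RV P >-> R}) b :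
  uniformly_distributed X ac -> is_partition a c b ->
  range_sampling_error X b =
    2 / (c - a) * \sum_(i < n) logcosh (half_log_ratio b i).
Proof.
move=> uX pb; rewrite mulr_sumr; apply: eq_bigr => i _.
have -> : P (X @^-1` cell b i) = ((c - a)^-1 * cell_length b i)%:E.
  rewrite EFinM -lebesgue_measure_cell// -(uniform_prob_subset ac)//.
  - by rewrite -uX//; exact: measurable_cell.
  - exact: measurable_cell.
  - exact: cell_subset.
rewrite cell_ratioE// -expRN/= -/(logcosh _).
by field; rewrite (gt_eqF (cell_length_gt0 _ pb)) gt_eqF ?subr_gt0.
Qed.

(** * Geometric breakpoints and their optimality *)

Hypothesis n_gt0 : (0 < n)%N.

Lemma ln_geometric_breakpoints (k : 'I_n.+1) :
  ln (geometric_breakpoints a c k) = ln a + k%:R / n%:R * (ln c - ln a).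
Proof.
have c0 : 0 < c := lt_trans a_gt0 ac.
by rewrite lnM ?posrE ?powR_gt0 ?divr_gt0// ln_powR ln_div.
Qed.

Lemma geometric_breakpoints_partition :
  is_partition a c (@geometric_breakpoints R n a c).
Proof.
have c0 : 0 < c := lt_trans a_gt0 ac.
have nn0 : n%:R != 0 :> R by rewrite pnatr_eq0 -lt0n.
rewrite /geometric_breakpoints; split.
- by rewrite mul0r powRr0 mulr1.
- by rewrite divff// powRr1 ?divr_ge0 ?ltW// mulrC divfK ?gt_eqF.
- move=> i j ij; rewrite ltr_pM2l// -ltr_ln ?posrE ?powR_gt0 ?divr_gt0//.
  rewrite !ln_powR ltr_pM2r; last by rewrite ln_gt0// ltr_pdivlMr// mul1r.
  by rewrite ltr_pM2r ?invr_gt0 ?ltr0n// ltr_nat.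
Qed.

Lemma half_log_ratio_geometric i :
  half_log_ratio (@geometric_breakpoints R n a c) i = (ln c - ln a) / 2 / n%:R.
Proof.
rewrite /half_log_ratio /right_end /left_end !ln_geometric_breakpoints lift0/=.
by rewrite -natr1; field; rewrite pnatr_eq0 -lt0n.
Qed.

(** On the logarithmic scale the breakpoints advance from [ln a] by equal steps, so induction on the
    index determines them all. *)
Lemma half_log_ratio_const b : is_partition a c b ->
  (forall i, half_log_ratio b i = (ln c - ln a) / 2 / n%:R) ->
  b = @geometric_breakpoints R n a c.
Proof.
move=> pb bE; apply/funext => k; apply: ln_inj; rewrite ?posrE.
- exact: partition_gt0.
- exact: partition_gt0 geometric_breakpoints_partition.
rewrite ln_geometric_breakpoints; case: k; elim=> [|k IH] kn.
  rewrite mul0r mul0r addr0; case: pb => <- _ _; congr (ln (b _)).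
  exact: val_inj.
have := bE (Ordinal (kn : (k < n)%N)); rewrite /half_log_ratio /right_end /left_end.
(* The ends of cell [k] are breakpoints [k + 1] and [k]; the ordinals differ only in their bound
   proofs. *)
have -> : lift ord0 (Ordinal (kn : (k < n)%N)) = Ordinal kn by exact: val_inj.
have -> : widen_ord (leqnSn n) (Ordinal (kn : (k < n)%N)) = Ordinal (ltnW kn).
  exact: val_inj.
rewrite IH/= => e.
have {}e := congr1 (fun x => x * 2) e; rewrite divfK// in e.
rewrite -(subrK (ln a + k%:R / n%:R * (ln c - ln a)) (ln _)) e -natr1.
by field; rewrite pnatr_eq0 -lt0n.
Qed.

Lemma geometric_breakpoints_error (d : measure_display) (T : measurableType d)
    (P : probability T R) (X : {RV P >-> R}) : uniformly_distributed X ac ->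
  range_sampling_error X (@geometric_breakpoints R n a c) =
    2 / (c - a) * (n%:R * logcosh ((ln c - ln a) / 2 / n%:R)).
Proof.
move=> uX; rewrite (range_sampling_errorE uX geometric_breakpoints_partition).
under eq_bigr do rewrite half_log_ratio_geometric.
by rewrite sumr_const card_ord; congr (_ * _); rewrite mulr_natl.
Qed.

Lemma geometric_breakpoints_minimizer (d : measure_display)
    (T : measurableType d) (P : probability T R) (X : {RV P >-> R}) b :
  uniformly_distributed X ac ->
  is_minimizer (is_partition a c) (range_sampling_error X) b <->
  b = @geometric_breakpoints R n a c.
Proof.
move=> uX; have ca : 0 < 2 / (c - a) by rewrite divr_gt0 ?subr_gt0.
have sumE b' : is_partition a c b' ->
    \sum_(i < n) half_log_ratio b' i = n%:R * ((ln c - ln a) / 2 / n%:R).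
  case=> b0 bn _; rewrite sum_half_log_ratio// [RHS]mulrC divfK//.
  by rewrite pnatr_eq0 -lt0n.
(* A minimizer does no worse than the geometric partition, so it attains Jensen's bound and all its
   log ratios equal the mean. Conversely, Jensen's bound is the same for every partition. *)
split=> [[pb /(_ _ geometric_breakpoints_partition)]|->].
  rewrite geometric_breakpoints_error// range_sampling_errorE//.
  rewrite ler_pM2l// => /(logcosh_sum_eq (sumE _ pb)).
  exact: half_log_ratio_const.
split; first exact: geometric_breakpoints_partition.
move=> b' pb'; rewrite geometric_breakpoints_error// range_sampling_errorE//.
by rewrite ler_pM2l// logcosh_sum_ge// sumE.
Qed.

End Partition.

Theorem proposition2 (R : realType) (d : measure_display)
    (T : measurableType d) (P : probability T R) (X : {RV P >-> R})
    (q : nat) (rmin rmax : R) (rmin_gt0 : 0 < rmin) (rmin_lt : rmin < rmax)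
    (X_uniform : uniformly_distributed X rmin_lt) :
  let N := (2 ^ q)%N in
  let xi := Num.sqrt (rmax / rmin) in
  let b_opt := @geometric_breakpoints R N rmin rmax in
  [/\ forall b : 'I_N.+1 -> R,
        is_minimizer (is_partition rmin rmax) (range_sampling_error X) b
        <-> b = b_opt,
      forall i : 'I_N,
        cell b_opt i =
        if i.+1 == N
        then [set` `[rmin * (rmax / rmin) `^ (i%:R / N%:R),
                     rmin * (rmax / rmin) `^ (i.+1%:R / N%:R)]]
        else [set` `[rmin * (rmax / rmin) `^ (i%:R / N%:R),
                     rmin * (rmax / rmin) `^ (i.+1%:R / N%:R)[]
    & range_sampling_error X b_opt =
        (2 ^ q.+1)%N%:R / (rmax - rmin)
        * ln ((xi `^ (N%:R^-1) + xi `^ (- N%:R^-1)) / 2)].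
Proof.
move=> N xi b_opt.
have N0 : (0 < N)%N by rewrite expn_gt0.
have rmax0 : 0 < rmax := lt_trans rmin_gt0 rmin_lt.
split=> [b|i|].
- exact: geometric_breakpoints_minimizer.
- by rewrite /cell /left_end /right_end /b_opt /geometric_breakpoints lift0.
- rewrite (geometric_breakpoints_error rmin_gt0 N0 X_uniform).
  have xiE : xi = expR ((ln rmax - ln rmin) / 2).
    rewrite /xi -powR12_sqrt ?divr_ge0 ?ltW//.
    by rewrite expRM expRB !lnK.
  (* The powers of [xi] are exponentials of plus and minus the mean log ratio. The factor [2 ^ q.+1]
     is the coefficient 2 of the objective times the [N = 2 ^ q] equal terms. *)
  rewrite xiE -!expRM mulrN expnS natrM /logcosh.
  by ring.
Qed.
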